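(* Let $t\geq 1$, $k\geq 2$ and $q\geq t+1$ be integers satisfying $q>4e^2\sqrt[k]{2e(t+1)^2}$, where $e$ is the base of the natural logarithm. Then a $(q,k,n)_{1,t}$-Armstrong code exists for \[n=\left\lfloor \sqrt[2k]{\frac{1}{2e(t+1)^2}}\,\frac{\sqrt{q}}{e}\,k\right\rfloor,\] i.e., \[f_{1,t}(q,k)\geq \left\lfloor\sqrt[2k]{\frac{1}{2e(t+1)^2}}\,\frac{\sqrt{q}}{e}\,k\right\rfloor.\]
   Context: Let $q>t\geq s\geq 1$ and $k>1$ be integers. View a $q$-ary code $C$ of length $n$ (a set of words of length $n$ over an alphabet of size $q$) as an array whose rows are the distinct codewords and whose columns are the $n$ coordinates. $C$ is called a $(q,k,n)_{s,t}$-Armstrong code if (i) for any $t+1$ (distinct) rows of $C$, there are at most $k-1$ columns such that each of them has at most $s$ distinct entries in these $t+1$ rows; and (ii) for any $k-1$ columns of $C$, there exist $t+1$ (distinct) rows such that each of the $k-1$ columns has at most $s$ distinct entries in these $t+1$ rows and, further, there exists a column of $C$ having exactly $t+1$ distinct entries in these same $t+1$ rows. $f_{s,t}(q,k)$ denotes the maximum $n$ such that a $(q,k,n)_{s,t}$-Armstrong code exists. *)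

(* Defs.v *)
From HB Require Import structures.
From mathcomp Require Import all_boot all_order all_algebra.
From mathcomp Require Import all_classical all_reals all_analysis.
Set Implicit Arguments.
Unset Strict Implicit.
Unset Printing Implicit Defensive.

(* Being a set of words, a code has pairwise distinct rows. *)
Definition qary_code (q n : nat) : predArgType := {set {ffun 'I_n -> 'I_q}}.

Definition entries (q n : nat) (A : qary_code q n) (j : 'I_n) : {set 'I_q} :=
  [set x j | x : {ffun 'I_n -> 'I_q} in A].

Definition armstrong (s t q k n : nat) (C : qary_code q n) : Prop :=
  (forall A : qary_code q n, A \subset C -> #|A| = t.+1 ->
     #|[set j | #|entries A j| <= s]| <= k.-1) /\
  (forall K : {set 'I_n}, #|K| = k.-1 ->
     exists A : qary_code q n,
       [/\ A \subset C,
           #|A| = t.+1,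
           forall j, j \in K -> #|entries A j| <= s
         & exists j, #|entries A j| = t.+1]).

Definition armstrong_length (s t q k n : nat) : Prop :=
  exists C : qary_code q n, armstrong s t k C.

Definition is_max (P : nat -> Prop) (m : nat) : Prop :=
  P m /\ forall n, P n -> n <= m.

(* The default value 0 is never used when q > t >= s >= 1 and k > 1, by
   [armstrong_maxP] below. *)
Definition armstrong_max (s t q k : nat) : nat :=
  xget 0 (is_max (armstrong_length s t q k)).

Lemma subset_of_card (T : finType) (X : {set T}) (m : nat) :
  m <= #|X| -> exists2 A : {set T}, A \subset X & #|A| = m.
Proof.
rewrite -bin_gt0 -cards_draws card_gt0 => /set0Pn[A].
by rewrite inE => /andP[AX /eqP Am]; exists A.
Qed.

Lemma column_pigeonhole (q n t : nat) (X : qary_code q n) (j : 'I_n) :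
  q * t < #|X| ->
  exists A : qary_code q n, [/\ A \subset X, #|A| = t.+1 & #|entries A j| <= 1].
Proof.
move=> ltX.
have [a ta] : exists a : 'I_q, t < #|[set x in X | x j == a]|.
  apply/existsP; apply: contraLR ltX => /existsPn le_t.
  rewrite -leqNgt -sum1_card (partition_big (fun x : {ffun 'I_n -> 'I_q} => x j) predT) //=.
  have -> : q * t = \sum_(a < q) t by rewrite sum_nat_const card_ord.
  apply: leq_sum => a _; rewrite sum1dep_card leqNgt.
  exact: le_t.
have [A sAX At] := subset_of_card ta.
exists A; split=> //.
  by apply: fintype.subset_trans sAX _; apply/fintype.subsetP => x; rewrite inE => /andP[].
rewrite -(cards1 a); apply: subset_leq_card; apply/fintype.subsetP => b.
case/imsetP=> x xA ->; move/fintype.subsetP: sAX => /(_ x xA).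
by rewrite !inE => /andP[].
Qed.

Lemma armstrong_length_bound (s t q k n : nat) :
  0 < s -> 1 < k -> armstrong_length s t q k n ->
  n <= k + 'C((q * t).+1, t.+1) * k.-1.
Proof.
move=> s0 k1 [C [C1 C2]].
have [nk|kn] := leqP n k; first exact: leq_trans nk (leq_addr _ _).
apply: leq_trans (leq_addl _ _).
have [X [sXC Xc Xcov]] : exists X : qary_code q n,
    [/\ X \subset C, #|X| <= (q * t).+1
      & forall j, exists A : qary_code q n,
          [/\ A \subset X, #|A| = t.+1 & #|entries A j| <= s]].
  have [leC|ltC] := leqP #|C| (q * t).
    exists C; split=> // [|j]; first exact: leqW.
    have [K' K's K'k] : exists2 K' : {set 'I_n}, K' \subset [set~ j] & #|K'| = k.-2.
      apply: subset_of_card; rewrite cardsC1 card_ord -ltnS (ltn_predK kn).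
      by apply: leq_ltn_trans kn; rewrite (leq_trans (leq_pred _)) ?leq_pred.
    have Kk : #|j |: K'| = k.-1.
      rewrite cardsU1 K'k.
      have -> : j \notin K'.
        by apply/negP => /(fintype.subsetP K's); rewrite !inE eqxx.
      by case: (k) k1 => [|[|?]].
    have [A [AC At AK _]] := C2 _ Kk.
    by exists A; split=> //; apply: AK; rewrite !inE eqxx.
  have [X sXC Xc] := subset_of_card ltC.
  exists X; split=> //; first by rewrite Xc.
  move=> j; have [|A [AX At A1]] := @column_pigeonhole q n t X j.
    by rewrite Xc.
  by exists A; split=> //; apply: leq_trans s0.
pose D := [set A : qary_code q n | A \subset X & #|A| == t.+1].
have cov : [set: 'I_n] \subset \bigcup_(A in D) [set j | #|entries A j| <= s].
  apply/fintype.subsetP => j _; have [A [AX At Aj]] := Xcov j.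
  by apply/finset.bigcupP; exists A; rewrite !inE ?AX ?At ?eqxx.
have := subset_leq_card cov; rewrite cardsT card_ord => /leq_trans; apply.
have step : #|\bigcup_(A in D) [set j | #|entries A j| <= s]| <= \sum_(A in D) k.-1.
  apply: (@leq_trans (\sum_(A in D) #|[set j | #|entries A j| <= s]|)).
    elim/big_ind2: _ => [|a x b y xa yb|//]; first by rewrite cards0.
    by apply: leq_trans (leq_add xa yb); rewrite cardsU leq_subr.
  apply: leq_sum => A; rewrite inE => /andP[AX /eqP At].
  by apply: C1 => //; apply: fintype.subset_trans sXC.
apply: leq_trans step _; rewrite sum_nat_const leq_mul2r; apply/orP; right.
by rewrite cards_draws leq_bin2l.
Qed.

Lemma armstrong_length0 (s t q k : nat) : 1 < k -> armstrong_length s t q k 0.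
Proof.
have I0 (K : {set 'I_0}) : #|K| = 0.
  by apply/eqP; rewrite cards_eq0; apply/eqP/setP => -[].
move=> k1; exists finset.set0; split=> [A _ _|K]; first by rewrite I0.
by rewrite I0; case: (k) k1 => [|[|?]].
Qed.

Lemma armstrong_maxP (s t q k : nat) :
  t < q -> s <= t -> 0 < s -> 1 < k ->
  is_max (armstrong_length s t q k) (armstrong_max s t q k).
Proof.
move=> _ _ s0 k1; apply: (@xgetPex _ 0 (is_max (armstrong_length s t q k))).
pose P n := `[< armstrong_length s t q k n >].
have exP : exists n, P n by exists 0; apply/asboolP/armstrong_length0.
have ubP n : P n -> n <= k + 'C((q * t).+1, t.+1) * k.-1.
  by move/asboolP; apply: armstrong_length_bound.
case: (ex_maxnP exP ubP) => m /asboolP Pm mmax.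
by exists m; split=> // n Pn; apply: mmax; apply/asboolP.
Qed.

(* Main.v *)
(** The code is built greedily, in the style of the Gilbert-Varshamov bound.
    To every set [K] of [k - 1] columns we attach [t + 1] words [w_K + u_(K,i)],
    where [u_(K,i)] vanishes on [K] and is constantly equal to [i] off [K].
    Words attached to the same [K] agree exactly on [K].  A given word agrees
    with [w_K + u_(K,i)] on at least [k] columns for at most
    ['C(n, k) * q ^ (n - k)] choices of [w_K], so the [w_K] can be chosen one
    after the other such that any two words of the code agree on fewer than [k]
    columns, as soon as [(t + 1)^2 * 'C(n, k) * 'C(n, k - 1) < q ^ k].
    This inequality follows from ['C(n, k) <= (e n / k)^k] and [2 k <= n]. *)
Require Import Defs.
From HB Require Import structures.
From mathcomp Require Import all_boot all_order all_algebra.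
From mathcomp Require Import all_classical all_reals all_analysis.
From mathcomp Require Import zify ring lra.
Set Implicit Arguments.
Unset Strict Implicit.
Unset Printing Implicit Defensive.

Import Order.TTheory GRing.Theory Num.Theory.
Local Open Scope ring_scope.

Lemma card_bigcup_le (I T : finType) (P : pred I) (F : I -> {set T}) :
  (#|\bigcup_(i | P i) F i| <= \sum_(i | P i) #|F i|)%N.
Proof.
elim/big_ind2: _ => [|a x b y xa yb|//]; first by rewrite cards0.
by apply: leq_trans (leq_add xa yb); rewrite cardsU leq_subr.
Qed.

Lemma exists_notin (T : finType) (A : {set T}) :
  (#|A| < #|T|)%N -> exists x, x \notin A.
Proof.
move=> ltA; apply/existsP; apply: contraLR ltA => /existsPn AT.
rewrite -leqNgt subset_leq_card //; apply/fintype.subsetP => x _.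
by rewrite -[_ \in _]negbK AT.
Qed.

(** By induction on the size of [A]: once the values on [A :\ a] are fixed, each other index forbids
    at most [c] values at [a], fewer than [#|W|] in total. Symmetry of [bad] lets one bound cover
    both orders of a pair. *)
Lemma greedy_choice (I W : finType) (bad : I -> W -> I -> W -> bool) (c : nat)
    (A : {set I}) :
  (forall a v b w, bad a v b w = bad b w a v) ->
  (forall a b w, #|[set v | bad a v b w]| <= c)%N ->
  (#|A| * c < #|W|)%N ->
  exists w : I -> W, {in A &, forall a b, a != b -> ~~ bad a (w a) b (w b)}.
Proof.
move=> bad_sym bad_le; have [m] := ubnP #|A|.
elim: m A => // m IHm A leAm ltAW.
have [->|[a aA]] := set_0Vmem A.
  have /card_gt0P[w0 _] : (0 < #|W|)%N by apply: leq_ltn_trans ltAW.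
  by exists (fun=> w0) => a b; rewrite inE.
have cardA := cardsD1 a A; rewrite aA add1n in cardA.
have [||w wP] := IHm (A :\ a).
- by rewrite -ltnS -cardA.
- by apply: leq_ltn_trans ltAW; rewrite leq_mul2r cardA leqnSn orbT.
pose B := (\bigcup_(b in A :\ a) [set v | bad a v b (w b)]).
have [v vB] : exists v, v \notin B.
  apply: exists_notin; apply: leq_ltn_trans ltAW.
  apply: leq_trans (card_bigcup_le _ _) _.
  apply: (@leq_trans (\sum_(b in A :\ a) c)); first exact: leq_sum.
  by rewrite sum_nat_const leq_mul2r cardA leqnSn orbT.
have good b : b \in A -> b != a -> ~~ bad a v b (w b).
  move=> bA ba; apply: contra vB => ab; apply/finset.bigcupP.
  by exists b; rewrite ?inE ?ba.
exists (fun b => if b == a then v else w b) => b d bA dA.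
have [->|ba] := eqVneq b a; have [->|da] := eqVneq d a => bd.
- by case/eqP: bd.
- exact: good.
- by rewrite bad_sym good.
- by apply: wP => //; rewrite !inE ?ba ?da.
Qed.

Definition agree (n : nat) (T : eqType) (x y : {ffun 'I_n -> T}) : {set 'I_n} :=
  [set j | x j == y j].

Lemma agreeC (n : nat) (T : eqType) (x y : {ffun 'I_n -> T}) :
  agree x y = agree y x.
Proof. by apply/setP => j; rewrite !inE eq_sym. Qed.

Lemma card_agree_on (n q : nat) (y : {ffun 'I_n -> 'I_q}) (J : {set 'I_n}) :
  #|[set w | J \subset agree w y]| = (q ^ (n - #|J|))%N.
Proof.
(* Such words form a product set: one letter is allowed on [J], all [q] letters off [J]. *)
pose F j : pred 'I_q := if j \in J then pred1 (y j) else predT.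
have -> : #|[set w | J \subset agree w y]| = #|family F|.
  apply: eq_card => w; rewrite inE.
  apply/fintype.subsetP/familyP => [h j|h j jJ]; last first.
    by have := h j; rewrite /F jJ !inE.
  by rewrite /F; case: ifP => // /h; rewrite !inE.
rewrite card_family foldrE big_image /= (bigID (mem J)) /=.
rewrite big1 ?mul1n => [|j jJ]; last by rewrite /F jJ card1.
rewrite (eq_bigr (fun=> q)) => [|j /negPf jJ]; last by rewrite /F jJ card_ord.
rewrite prod_nat_const; congr (q ^ _)%N.
by rewrite -[X in (X - _)%N](card_ord n) -(cardC (mem J)) addKn.
Qed.

(** Union bound over the [k]-subsets [J] of the columns on which the two words may agree. *)
Lemma card_agree_ge (n q k : nat) (y : {ffun 'I_n -> 'I_q}) :
  (#|[set w | k <= #|agree w y|]| <= 'C(n, k) * q ^ (n - k))%N.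
Proof.
pose D := [set J : {set 'I_n} | #|J| == k].
have cardD : #|D| = 'C(n, k).
  rewrite -[in RHS](card_ord n) -cardsT -cards_draws.
  by apply: eq_card => J; rewrite !inE finset.subsetT.
have sub : [set w | (k <= #|agree w y|)%N]
    \subset (\bigcup_(J in D) [set w | J \subset agree w y]).
  apply/fintype.subsetP => w; rewrite inE => /subset_of_card[J Jw Jk].
  by apply/finset.bigcupP; exists J; rewrite inE ?Jk.
apply: leq_trans (subset_leq_card sub) _.
apply: leq_trans (card_bigcup_le _ _) _.
rewrite -cardD -sum_nat_const; apply: leq_sum => J; rewrite inE => /eqP Jk.
by rewrite card_agree_on Jk.
Qed.

Lemma card_entries_le1 (q n : nat) (A : qary_code q n) (x y : {ffun 'I_n -> 'I_q})
    (j : 'I_n) :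
  x \in A -> y \in A -> (#|entries A j| <= 1)%N -> x j = y j.
Proof.
by move=> xA yA /card_le1_eqP; apply; apply/imsetP; [exists y | exists x].
Qed.

Lemma armstrong_of_binomial (q t k n : nat) :
  (0 < t < q)%N -> (0 < k <= n)%N ->
  (t.+1 ^ 2 * 'C(n, k) * 'C(n, k.-1) < q ^ k)%N ->
  exists C : qary_code q n, armstrong 1 t k C.
Proof.
(* Writing the alphabet as ['I_q.+1] gives it addition modulo [q.+1], so that words can be added and
   translated. *)
case: q => [|q]; first by rewrite ltn0 andbF.
move=> /andP[t0 tq] /andP[k0 kn] small.
pose u (K : {set 'I_n}) (i : 'I_t.+1) : {ffun 'I_n -> 'I_q.+1} :=
  [ffun j => if j \in K then 0 else inord i].
pose I := [set K : {set 'I_n} | #|K| == k.-1].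
have cardI : #|I| = 'C(n, k.-1).
  rewrite -[in RHS](card_ord n) -cardsT -cards_draws.
  by apply: eq_card => J; rewrite !inE finset.subsetT.
pose bad K (v : {ffun 'I_n -> 'I_q.+1}) L (w : {ffun 'I_n -> 'I_q.+1}) :=
  [exists i, exists l, (k <= #|agree (v + u K i)%R (w + u L l)%R|)%N].
have [K v L w|K L w||w wP] :=
    @greedy_choice _ _ bad (t.+1 ^ 2 * 'C(n, k) * q.+1 ^ (n - k)) I.
- by apply/existsP/existsP => -[i /existsP[l il]]; exists l; apply/existsP; exists i;
    rewrite agreeC.
(* Moving [u K i] to the other side turns a collision into an agreement of [v] itself with one of
   [t.+1 ^ 2] fixed words, one for each pair [(i, l)]. *)
- have sub : [set v | bad K v L w] \subset
      (\bigcup_(il : 'I_t.+1 * 'I_t.+1)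
         [set v | (k <= #|agree v (w + u L il.2 - u K il.1)%R|)%N]).
    apply/fintype.subsetP => v; rewrite inE => /existsP[i /existsP[l il]].
    apply/finset.bigcupP; exists (i, l) => //=; rewrite inE (leq_trans il) //.
    by rewrite subset_leq_card //; apply/fintype.subsetP => j;
      rewrite !inE !ffunE => /eqP <-; rewrite addrK.
  apply: leq_trans (subset_leq_card sub) _.
  apply: leq_trans (card_bigcup_le _ _) _.
  apply: (@leq_trans (\sum_(il : 'I_t.+1 * 'I_t.+1) 'C(n, k) * q.+1 ^ (n - k))%N).
    by apply: leq_sum => il _; apply: card_agree_ge.
  by rewrite sum_nat_const card_prod !card_ord mulnA.
(* After cancelling [q.+1 ^ (n - k)] from both sides, the greedy condition is the hypothesis
   [small]. *)
- rewrite cardI card_ffun !card_ord -[X in (_ < _ ^ X)%N](subnK kn) expnD mulnA.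
  by rewrite (mulnC 'C(n, k.-1)) [X in (_ < X)%N]mulnC ltn_pmul2r ?expn_gt0.
pose G K : qary_code q.+1 n := [set w K + u K i | i : 'I_t.+1].
have agreeG K i l : i != l -> agree (w K + u K i) (w K + u K l) = K.
  move=> il; apply/setP => j; rewrite !inE !ffunE (inj_eq (addrI _)).
  case: ifP => // _.
  (* Since [t < q.+1], [inord] keeps the value of [i], so distinct indices give distinct letters off
     [K]. *)
  apply/negP => /eqP /(congr1 val); rewrite /= !inordK => [/val_inj e||].
  - by rewrite e eqxx in il.
  - by rewrite (leq_trans (ltn_ord _)).
  - by rewrite (leq_trans (ltn_ord _)).
exists (\bigcup_(K in I) G K); split=> [A AC At|K Kk].
  (* With [s = 1], a counted column is constant on [A], so any two distinct rows of [A] agree there;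
     two such rows exist because [0 < t]. *)
  have [x [y [xA yA xy]]] : exists x y, [/\ x \in A, y \in A & x != y].
    by apply/card_gt1P; rewrite At ltnS.
  have le_agree : (#|agree x y| <= k.-1)%N.
    have /finset.bigcupP[K KI /imsetP[i _ ex]] := fintype.subsetP AC _ xA.
    have /finset.bigcupP[L LI /imsetP[l _ ey]] := fintype.subsetP AC _ yA.
    move: xy; rewrite {}ex {}ey; have [->|KL xy] := eqVneq K L.
      have [->|il _] := eqVneq i l; first by rewrite eqxx.
      by rewrite agreeG //; move: LI; rewrite inE => /eqP->.
    rewrite -ltnS prednK // ltnNge; apply: contra (wP _ _ KI LI KL) => le_k.
    by apply/existsP; exists i; apply/existsP; exists l.
  apply: leq_trans le_agree; apply/subset_leq_card/fintype.subsetP => j.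
  by rewrite !inE => /(card_entries_le1 xA yA) ->.
(* Injectivity at one column off [K] yields both that [G K] has [t.+1] words and that this column
   has [t.+1] entries. *)
have [j jK] : exists j, j \notin K by apply: exists_notin; rewrite card_ord Kk prednK.
have injr (i l : 'I_t.+1) : (w K + u K i) j = (w K + u K l) j -> i = l.
  move=> e; apply/eqP; apply: contraNT jK => il.
  by rewrite -(agreeG K i l il) inE e.
exists (G K); split.
- by apply: (finset.bigcup_max K) => //; rewrite inE Kk.
- by rewrite card_imset ?card_ord // => i l e; apply: injr; rewrite e.
- move=> l lK; apply/card_le1_eqP => x y /imsetP[_ /imsetP[i _ ->] ->].
  by move=> /imsetP[_ /imsetP[m _ ->] ->]; rewrite !ffunE lK.
- exists j; rewrite -[in RHS](card_ord t.+1).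
  have -> : entries (G K) j = [set (w K + u K i) j | i : 'I_t.+1].
    by rewrite /entries /G -imset_comp.
  by rewrite card_imset // => i l; apply: injr.
Qed.

(** For positive [k] the ratio of the two coefficients is [(n - k + 1) / k], which is at least 1
    here. *)
Lemma bin_pred_le (n k : nat) : (2 * k <= n)%N -> ('C(n, k.-1) <= 'C(n, k))%N.
Proof.
case: k => // k le_kn; rewrite -(leq_pmul2l (ltn0Sn k)) mul_bin_left leq_mul2r.
by apply/orP; right; rewrite /= -(leq_add2r k) subnK; lia.
Qed.

Lemma bin_le_expR (R : realType) (n k : nat) : (0 < k)%N ->
  'C(n, k)%:R <= (expR 1 * n%:R / k%:R) ^+ k :> R.
Proof.
case: k => // k _.
(* The exponential series at [k.+1] dominates its term of degree [k.+1]. *)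
have kk : (k.+1%:R : R) ^+ k.+1 <= expR 1 ^+ k.+1 * (k.+1)`!%:R.
  rewrite -ler_pdivrMr ?ltr0n ?fact_gt0 // -expRM_natl mulr1.
  by apply: le_trans (expR_ge1Dxn k (ler0n R k.+1)); rewrite lerDr.
have nk : 'C(n, k.+1)%:R * (k.+1)`!%:R <= (n%:R : R) ^+ k.+1.
  rewrite -natrM -natrX ler_nat bin_ffact ffact_prod.
    by rewrite -[X in (_ ^ X)%N]card_ord -prod_nat_const leq_prod // => i _; apply: leq_subr.
rewrite expr_div_n ler_pdivlMr ?exprn_gt0 ?ltr0n // exprMn.
apply: le_trans (ler_wpM2l (ler0n _ _) kk) _.
rewrite mulrCA; apply: ler_wpM2l nk.
by rewrite exprn_ge0 ?expR_ge0.
Qed.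

Theorem proposition17 (R : realType) (t k q : nat)
    (t_ge1 : (1 <= t)%N) (k_ge2 : (2 <= k)%N) (q_gt_t : (t + 1 <= q)%N)
    (q_large : 4 * expR 1 ^+ 2
                 * (2 * expR 1 * (t%:R + 1) ^+ 2) `^ (1 / k%:R) < q%:R :> R) :
  let n := Num.truncn
    ((1 / (2 * expR 1 * (t%:R + 1) ^+ 2)) `^ (1 / (2 * k)%:R)
       * (Num.sqrt q%:R / expR 1) * k%:R : R) in
  (exists C : qary_code q n, armstrong 1 t k C)
  /\ (n <= armstrong_max 1 t q k)%N.
Proof.
set b : R := 2 * expR 1 * _ in q_large *; set e : R := expR 1 in b q_large *.
set r : R := _ `^ (1 / (2 * k)%:R); set s : R := Num.sqrt q%:R => n.
have k0 : (0 < k)%N := ltnW k_ge2.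
have e0 : 0 < e := expR_gt0 1.
have b0 : 0 < b by rewrite !mulr_gt0 // exprn_gt0 // ltr_wpDl.
have r0 : 0 < r by apply: powR_gt0; rewrite divr_gt0.
have s0 : 0 <= s := sqrtr_ge0 _.
have s2 : s ^+ 2 = q%:R by rewrite sqr_sqrtr.
have r2 : r ^+ 2 = (b `^ (1 / k%:R))^-1.
  rewrite -powR_mulrn ?(ltW r0) // /r -powRrM natrM !mul1r.
  have -> : (2 * k%:R)^-1 * 2 = k%:R^-1 :> R.
    by rewrite invfM mulrAC mulVf ?mul1r // pnatr_eq0.
  by rewrite -powRN -powR_inv1 ?(ltW b0) // -powRrM mulN1r.
have r2k : r ^+ (2 * k) = b^-1.
  rewrite exprM r2 exprVn -powR_mulrn ?powR_ge0 // -powRrM mul1r mulVf.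
    by rewrite powRr1 // ltW.
  by rewrite pnatr_eq0 -lt0n.
(* [truncn] is bounded by its argument only when that argument is nonnegative. *)
have X0 : 0 <= r * (s / e) * k%:R by rewrite !mulr_ge0 ?invr_ge0 ?(ltW r0) ?(ltW e0).
have n_le : n%:R <= r * (s / e) * k%:R by rewrite truncn_le.
have n_ge : (2 * k <= n)%N.
  rewrite truncn_ge_nat // natrM; apply: ler_wpM2r => //.
  rewrite mulrA ler_pdivlMr // -ler_sqr ?nnegrE ?mulr_ge0 ?(ltW r0) ?(ltW e0) //.
  rewrite !exprMn r2 s2 [X in _ <= X]mulrC ler_pdivlMr ?powR_gt0 //.
  by rewrite -natrX ltW.
have q_pos : (t < q)%N by rewrite -addn1.
have small : (t.+1 ^ 2 * 'C(n, k) * 'C(n, k.-1) < q ^ k)%N.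
  apply: (@leq_ltn_trans (t.+1 ^ 2 * 'C(n, k) * 'C(n, k))).
    by rewrite leq_mul2l bin_pred_le ?orbT.
  rewrite -mulnA mulnn -(ltr_nat R) natrM !natrX.
  (* The choice of [n] gives [e * n / k <= r * s], and [r] is the [2 * k]-th root of [b^-1]. *)
  have C_le : ('C(n, k)%:R : R) ^+ 2 <= q%:R ^+ k / b.
    apply: (@le_trans _ _ ((r * s) ^+ (2 * k))).
      rewrite mulnC exprM; apply: lerXn2r; rewrite ?nnegrE //.
        by rewrite exprn_ge0 // mulr_ge0 // ltW.
      apply: le_trans (bin_le_expR R n k0) _; apply: lerXn2r.
      - by rewrite nnegrE !mulr_ge0 ?invr_ge0 ?(ltW e0).
      - by rewrite nnegrE mulr_ge0 // ltW.
      - rewrite ler_pdivrMr ?ltr0n // -ler_pdivlMl //.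
        by apply: le_trans n_le _; rewrite le_eqVlt; apply/orP; left; apply/eqP; ring.
    by rewrite exprMn r2k exprM s2 mulrC.
  apply: le_lt_trans (ler_wpM2l _ C_le) _; first by rewrite exprn_ge0.
  have qk0 : 0 < (q%:R : R) ^+ k by rewrite exprn_gt0 // ltr0n (leq_ltn_trans _ q_pos).
  (* What remains is [(t + 1) ^ 2 < b], that is [1 < 2 * e]. *)
  rewrite mulrCA -[X in _ < X]mulr1 ltr_pM2l // ltr_pdivrMr // mul1r.
  rewrite /b natr1 -[X in X < _]mul1r ltr_pM2r ?exprn_gt0 ?ltr0n //.
  by have := expR_ge1Dx (1 : R); rewrite -/e; lra.
have exC : exists C : qary_code q n, armstrong 1 t k C.
  apply: armstrong_of_binomial => //; first by rewrite t_ge1.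
  by rewrite k0 (leq_trans _ n_ge) // leq_pmull.
split=> //.
by have [_] := @armstrong_maxP 1 t q k q_pos t_ge1 isT k_ge2; apply.
Qed.
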